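(* Let $k$ be a field of characteristic other than $2$ or $3$. Let $(A,\mathfrak m_A,k)$ be a local Artinian Gorenstein $k$-algebra such that $k\to A/\mathfrak m_A$ is an isomorphism. Suppose that for some $n$ the Hilbert function of $A$ is $(1,n,n,1)$ or $\left(1,n,\binom{n+1}{2},n,1\right)$. Then $A$ is isomorphic (as a $k$-algebra) to its associated graded algebra $\operatorname{gr}A=\bigoplus_{i\ge 0}\mathfrak m_A^i/\mathfrak m_A^{i+1}$.
   Context: The Hilbert function of a local Artinian $k$-algebra $A$ with maximal ideal $\mathfrak m_A$ is $H_A(i)=\dim_k \mathfrak m_A^i/\mathfrak m_A^{i+1}$, written as the vector $(H_A(0),H_A(1),\dots,H_A(d))$ where $d$ is the largest index with $H_A(d)\neq 0$. *)

(* Defs.v *)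
From HB Require Import structures.
From mathcomp Require Import all_boot all_algebra.
From mathcomp Require Import boolp classical_sets.

Set Implicit Arguments.
Unset Strict Implicit.
Unset Printing Implicit Defensive.

Import GRing.Theory.
Local Open Scope ring_scope.
Local Open Scope classical_set_scope.

Section Ideals.
Variable A : comNzRingType.
Implicit Types I J M : set A.

(* The library's [idealr] only covers proper ideals; here the unit ideal is
   allowed. *)
Definition is_ideal I : Prop :=
  [/\ I 0, forall x y, I x -> I y -> I (x + y) & forall a x, I x -> I (a * x)].

Definition artinian : Prop :=
  forall I : nat -> set A, (forall i, is_ideal (I i)) ->
    (forall i, I i.+1 `<=` I i) ->
    exists N, forall i, (N <= i)%N -> I i = I N.

Definition maximal_ideal M : Prop :=
  [/\ is_ideal M, M <> setT &
      forall J, is_ideal J -> M `<=` J -> J = M \/ J = setT].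

Definition local_with M : Prop :=
  maximal_ideal M /\ forall M', maximal_ideal M' -> M' = M.

Definition ideal_mul I J : set A :=
  [set x | exists2 s : seq (A * A),
     (forall p, p \in s -> I p.1 /\ J p.2) & x = \sum_(p <- s) p.1 * p.2].

Fixpoint ideal_exp I (i : nat) : set A :=
  if i is j.+1 then ideal_mul I (ideal_exp I j) else setT.

Definition annihilator I : set A := [set x | forall y, I y -> y * x = 0].

Lemma is_ideal_mul I J : is_ideal J -> is_ideal (ideal_mul I J).
Proof.
move=> [J0 JD JM]; split.
- by exists [::] => //; rewrite big_nil.
- move=> _ _ [s hs ->] [t ht ->]; exists (s ++ t); last by rewrite big_cat.
  by move=> p; rewrite mem_cat => /orP[/hs|/ht].
- move=> a _ [s hs ->]; exists [seq (p.1, a * p.2) | p <- s].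
    by move=> _ /mapP[p /hs[Ip Jp] ->]; split=> //=; exact: JM.
  rewrite big_map mulr_sumr; apply: eq_bigr => p _ /=.
  by rewrite mulrCA.
Qed.

Lemma is_ideal_exp I i : is_ideal (ideal_exp I i).
Proof. by elim: i => [|i IH] //=; apply: is_ideal_mul. Qed.

Lemma is_ideal_sum I (K : Type) (r : seq K) (P : pred K) (F : K -> A) :
  is_ideal I -> (forall j, P j -> I (F j)) -> I (\sum_(j <- r | P j) F j).
Proof. by case=> I0 ID _ h; apply: big_ind. Qed.

Lemma is_idealN I x : is_ideal I -> I x -> I (- x).
Proof. by case=> _ _ IM /(IM (-1)); rewrite mulN1r. Qed.

Lemma ideal_expD I i j x y :
  ideal_exp I i x -> ideal_exp I j y -> ideal_exp I (i + j) (x * y).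
Proof.
elim: i x => [|i IH] x /=.
  by move=> _; rewrite add0n; case: (is_ideal_exp I j) => _ _; apply.
move=> [s hs ->] hy; exists [seq (p.1, p.2 * y) | p <- s].
  by move=> _ /mapP[p /hs[Ip Jp] ->]; split=> //=; exact: IH.
by rewrite big_map mulr_suml; apply: eq_bigr => p _ /=; rewrite mulrA.
Qed.

Lemma ideal_exp1 I x : is_ideal I -> ideal_exp I 1 x -> I x.
Proof.
move=> hI [s hs ->]; rewrite big_seq; apply: is_ideal_sum => // p /hs[Ip _].
by case: hI => _ _ IM; rewrite mulrC; exact: IM.
Qed.

End Ideals.

Section Dimension.
Variables (k : fieldType) (A : comAlgType k).

(* For k-subspaces V of U: dim_k U / V = d, i.e. the classes modulo V of some
   e_0, ..., e_(d-1) in U form a k-basis of U / V. *)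
Definition quot_dim (U V : set A) (d : nat) : Prop :=
  exists2 e : 'I_d -> A, (forall i, U (e i)) &
    forall x, U x -> exists! c : {ffun 'I_d -> k}, V (x - \sum_i c i *: e i).

(* A local Artinian ring with maximal ideal M is Gorenstein when its socle
   (0 : M) is one-dimensional over the residue field, which is k in the setting
   considered here. *)
Definition gorenstein (M : set A) : Prop :=
  quot_dim (annihilator M) [set 0] 1.

(* The last entry of h must be the last nonzero value of the Hilbert function *)
Definition hilbert_function (M : set A) (h : seq nat) : Prop :=
  last 0%N h != 0%N /\
  forall i, quot_dim (ideal_exp M i) (ideal_exp M i.+1) (nth 0%N h i).

End Dimension.

(* The associated graded ring of A with respect to I, built as
     (\bigoplus_i I^i) / (\bigoplus_i I^i.+1) = \bigoplus_i (I^i / I^i.+1),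
   where \bigoplus_i I^i is the subring of {poly A} of the polynomials whose
   i-th coefficient lies in I^i, and \bigoplus_i I^i.+1 is an ideal of it.
   Lemmas [symbol_eq], [symbolM], [gr_sum_symbol] and [gr_sum_symbol_inj] below
   check that this is the direct sum of the I^i / I^i.+1 with the expected
   product. *)
Section AssociatedGraded.
Variables (k : fieldType) (A : comAlgType k) (I : idealr A).

Definition iexp : nat -> set A := ideal_exp [set` I].

Lemma idealr_is_ideal : is_ideal [set` I].
Proof.
split=> /= [|x y|a x]; [exact: rpred0 | exact: rpredD | exact: idealMr].
Qed.

Lemma iexpP i : is_ideal (iexp i). Proof. exact: is_ideal_exp. Qed.

Lemma iexpB i x y : iexp i x -> iexp i y -> iexp i (x - y).
Proof.
by case: (iexpP i) => _ h _ hx hy; apply: h => //; apply: is_idealN (iexpP i) _.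
Qed.

Lemma iexp0 i : iexp i 0. Proof. by case: (iexpP i). Qed.

Definition rees_pred : {pred {poly A}} :=
  [pred p : {poly A} | `[< forall i, iexp i p`_i >]].

Lemma reesP (p : {poly A}) : reflect (forall i, iexp i p`_i) (p \in rees_pred).
Proof. exact: asboolP. Qed.

Lemma rees_subring_closed : subring_closed rees_pred.
Proof.
split.
- by apply/reesP => -[|i]; rewrite coef1 //; exact: iexp0.
- move=> p q /reesP hp /reesP hq; apply/reesP => i.
  by rewrite coefB; apply: iexpB.
- move=> p q /reesP hp /reesP hq; apply/reesP => i.
  rewrite coefM; apply: is_ideal_sum; first exact: iexpP.
  move=> j _; have hj : (j <= i)%N by rewrite -ltnS.
  by rewrite -[X in iexp X](subnKC hj); exact: ideal_expD (hp _) (hq _).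
Qed.
HB.instance Definition _ :=
  GRing.isSubringClosed.Build {poly A} rees_pred rees_subring_closed.

Definition rees := {p : {poly A} | p \in rees_pred}.
HB.instance Definition _ := SubChoice.on rees.
HB.instance Definition _ := [SubChoice_isSubComNzRing of rees by <:].

Definition rees_shift : {pred rees} :=
  [pred p : rees | `[< forall i, iexp i.+1 (val p)`_i >]].

Lemma rees_shiftP (p : rees) :
  reflect (forall i, iexp i.+1 (val p)`_i) (p \in rees_shift).
Proof. exact: asboolP. Qed.

Lemma rees_shift_idealr_closed : idealr_closed rees_shift.
Proof.
split.
- by apply/rees_shiftP=> i; rewrite rmorph0 coef0; exact: iexp0.
- apply/rees_shiftP => /(_ 0%N); rewrite rmorph1 coef1 /=.
  by move/(ideal_exp1 idealr_is_ideal) => /=; rewrite idealr1.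
- move=> p q r /rees_shiftP hq /rees_shiftP hr; apply/rees_shiftP => i.
  rewrite rmorphD rmorphM coefD coefM.
  have [_ h _] := iexpP i.+1; apply: h => //.
  apply: is_ideal_sum; first exact: iexpP.
  move=> j _; have hj : (j <= i)%N by rewrite -ltnS.
  rewrite -[X in iexp X.+1](subnKC hj) -addnS.
  by apply: ideal_expD (hq _); exact/reesP/(valP p).
Qed.
HB.instance Definition _ :=
  isIdealr.Build rees rees_shift rees_shift_idealr_closed.

Definition gr := {ideal_quot rees_shift}.
HB.instance Definition _ := GRing.ComNzRing.on gr.

Definition gr_class (p : rees) : gr := \pi_gr%qT p.

Lemma rees_const_subproof (c : k) : (c%:A)%:P \in rees_pred.
Proof. by apply/reesP => -[|i]; rewrite coefC //; exact: iexp0. Qed.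

Definition rees_const (c : k) : rees :=
  exist (fun p => p \in rees_pred) (c%:A)%:P (rees_const_subproof c).

(* c acts on gr as multiplication by the class of the constant polynomial
   c%:A, so as c on each I^i / I^i.+1. *)
Definition gr_scale (c : k) (x : gr) : gr := gr_class (rees_const c) * x.

Lemma gr_class0 : gr_class 0 = 0.
Proof. exact: (rmorph0 \pi_gr%qT). Qed.

Lemma gr_class1 : gr_class 1 = 1.
Proof. exact: (rmorph1 \pi_gr%qT). Qed.

Lemma gr_classD p q : gr_class (p + q) = gr_class p + gr_class q.
Proof. by rewrite /gr_class !piE. Qed.

Lemma gr_classM p q : gr_class (p * q) = gr_class p * gr_class q.
Proof. by rewrite /gr_class !piE. Qed.

Lemma gr_scaleA a b x : gr_scale a (gr_scale b x) = gr_scale (a * b) x.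
Proof.
rewrite /gr_scale mulrA -gr_classM; congr (gr_class _ * _); apply: val_inj.
by rewrite rmorphM /= -polyCM -scalerAl mul1r scalerA.
Qed.

Lemma gr_scale1 : left_id 1 gr_scale.
Proof.
move=> x; rewrite /gr_scale (_ : rees_const 1 = 1).
  by rewrite gr_class1 mul1r.
by apply: val_inj; rewrite rmorph1 /= scale1r.
Qed.

Lemma gr_scaleDr : right_distributive gr_scale +%R.
Proof. by move=> c x y; rewrite /gr_scale mulrDr. Qed.

Lemma gr_scaleDl x : {morph gr_scale^~ x : a b / a + b}.
Proof.
move=> a b; rewrite /gr_scale -mulrDl -gr_classD; congr (gr_class _ * _).
by apply: val_inj; rewrite rmorphD /= -polyCD scalerDl.
Qed.
HB.instance Definition _ :=
  GRing.Zmodule_isLmodule.Build k gr gr_scaleA gr_scale1 gr_scaleDr gr_scaleDl.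

Lemma gr_scaleAl (c : k) (x y : gr) : c *: (x * y) = c *: x * y.
Proof. exact: mulrA. Qed.
HB.instance Definition _ := GRing.Lmodule_isLalgebra.Build k gr gr_scaleAl.

Lemma gr_scaleAr (c : k) (x y : gr) : c *: (x * y) = x * (c *: y).
Proof. exact: mulrCA. Qed.
HB.instance Definition _ := GRing.Lalgebra_isAlgebra.Build k gr gr_scaleAr.

Lemma rees_monomial_subproof i x :
  (if `[< iexp i x >] then x else 0) *: 'X^i \in rees_pred.
Proof.
apply/reesP => j; rewrite coefZ coefXn; case: eqP => [->|_].
  by rewrite mulr1; case: asboolP => // _; exact: iexp0.
by rewrite mulr0; exact: iexp0.
Qed.

(* For x in I^i, the class of x in I^i / I^i.+1 as an element of gr (and 0 for
   x outside I^i) *)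
Definition symbol (i : nat) (x : A) : gr :=
  
  gr_class (exist (fun p => p \in rees_pred) _ (rees_monomial_subproof i x)).

Lemma gr_class_eq p q :
  gr_class p = gr_class q <-> forall i, iexp i.+1 ((val p)`_i - (val q)`_i).
Proof.
split=> [/eqP|h].
  rewrite -Quotient.idealrBE => /rees_shiftP h i.
  by have := h i; rewrite rmorphB coefB.
apply/eqP; rewrite -Quotient.idealrBE; apply/rees_shiftP => i.
by rewrite rmorphB coefB.
Qed.

Lemma coef_symbol i x j : iexp i x ->
  ((if `[< iexp i x >] then x else 0) *: 'X^i)`_j = if j == i then x else 0.
Proof.
move=> hx; rewrite (asboolT hx) coefZ coefXn.
by case: eqP => _; rewrite ?mulr1 ?mulr0.
Qed.

Lemma symbol_eq i x y : iexp i x -> iexp i y ->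
  symbol i x = symbol i y <-> iexp i.+1 (x - y).
Proof.
move=> hx hy; split=> [/gr_class_eq/(_ i)|h].
  by rewrite /= !coef_symbol // eqxx.
apply/gr_class_eq => j; rewrite /= !coef_symbol //.
by case: eqP => [->//|_]; rewrite subrr; exact: iexp0.
Qed.

Lemma symbolD i x y : iexp i x -> iexp i y ->
  symbol i (x + y) = symbol i x + symbol i y.
Proof.
move=> hx hy; have hxy : iexp i (x + y) by case: (iexpP i) => _ + _; apply.
rewrite -gr_classD; congr gr_class; apply: val_inj => /=.
by rewrite !asboolT // scalerDl.
Qed.

Lemma symbolZ i c x : iexp i x -> symbol i (c *: x) = c *: symbol i x.
Proof.
move=> hx; have hcx : iexp i (c *: x).
  by case: (iexpP i) => _ _ /(_ c%:A x hx); rewrite -scalerAl mul1r.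
rewrite [RHS]/GRing.scale /= /gr_scale -gr_classM; congr gr_class.
apply: val_inj => /=.
by rewrite !asboolT // mul_polyC scalerA -scalerAl mul1r.
Qed.

Lemma symbol1 : symbol 0 1 = 1.
Proof.
rewrite -gr_class1; congr gr_class; apply: val_inj => /=.
by rewrite asboolT // expr0 scale1r.
Qed.

Lemma symbolM i j x y : iexp i x -> iexp j y ->
  symbol i x * symbol j y = symbol (i + j) (x * y).
Proof.
move=> hx hy; have hxy : iexp (i + j) (x * y) by exact: ideal_expD.
rewrite -gr_classM; congr gr_class; apply: val_inj => /=.
by rewrite !asboolT // -scalerAl -scalerAr scalerA exprD.
Qed.

Lemma sum_symbolE d (x : nat -> A) : (forall i, iexp i (x i)) ->
  exists2 p : rees, val p = \poly_(i < d) x i &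
    \sum_(i < d) symbol i (x i) = gr_class p.
Proof.
move=> hx; elim: d => [|d [p Ep IH]].
  exists 0; first by rewrite rmorph0 poly_def big_ord0.
  by rewrite big_ord0 gr_class0.
rewrite big_ord_recr /= IH -gr_classD.
set q := exist _ _ _; exists (p + q); last by [].
rewrite [LHS](rmorphD (val : rees -> {poly A})) /= Ep !poly_def big_ord_recr /=.
by rewrite (asboolT (hx d)).
Qed.

Lemma gr_sum_symbol (z : gr) : exists d (x : nat -> A),
  (forall i, iexp i (x i)) /\ z = \sum_(i < d) symbol i (x i).
Proof.
elim/quotW: z => p; exists (size (val p)), (fun i => (val p)`_i).
have hp i : iexp i (val p)`_i by exact/reesP/(valP p).
split=> //; have [q Eq ->] := sum_symbolE (size (val p)) hp.
by congr gr_class; apply: val_inj; rewrite Eq coefK.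
Qed.

Lemma gr_sum_symbol_inj d (x : nat -> A) : (forall i, iexp i (x i)) ->
  \sum_(i < d) symbol i (x i) = 0 ->
  forall i, (i < d)%N -> symbol i (x i) = 0.
Proof.
move=> hx; have [p Ep ->] := sum_symbolE d hx.
rewrite -gr_class0 => /gr_class_eq hp i ltid; apply/gr_class_eq => j.
rewrite rmorph0 coef0 subr0 /= coef_symbol //; case: eqP => [->|_].
  by have := hp i; rewrite Ep rmorph0 coef0 subr0 coef_poly ltid.
exact: iexp0.
Qed.

End AssociatedGraded.

Definition alg_isomorphic (k : fieldType) (A B : comAlgType k) : Prop :=
  exists f : {lrmorphism A -> B}, bijective f.

(* Main.v *)
Require Import Defs.
From HB Require Import structures.
From mathcomp Require Import all_boot all_algebra ring.
From mathcomp Require Import boolp classical_sets.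

Set Implicit Arguments.
Unset Strict Implicit.
Unset Printing Implicit Defensive.

Import GRing.Theory.
Local Open Scope ring_scope.
Local Open Scope classical_set_scope.

(* A is isomorphic to gr A as soon as some lift v_1, ..., v_n of a basis of
   m / m^2 has the property that, for every i, the span of its monomials of
   degree i meets m^(i+1) in 0.  Let d be the socle degree and choose a linear
   form phi on m^(d-1) that is injective on the socle m^d.  In degree d-1 it
   suffices that phi kills the monomials; since (0 : m) = m^d makes the pairings
   phi(xy) perfect, this is achieved by replacing v_i by v_i + w_i with w_i in
   m^2, as terms with two factors w vanish:
     d = 3:  phi(v_i w_j) = - phi(v_i v_j) / 2,
     d = 4:  phi(v_i v_j w_l) = - phi(v_i v_j v_l) / 3,
   the latter being solvable because dim m^2 / m^3 is the number of pairs
   i <= j.  The same count gives the condition in degree 2 when d = 4, and the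
   other degrees are immediate. *)

(** * Ideals, units and Nakayama's lemma in local Artinian rings *)

Section IdealFacts.
Variable A : comNzRingType.
Implicit Types I J M : set A.

Lemma is_idealD I x y : is_ideal I -> I x -> I y -> I (x + y).
Proof. by case=> _ ID _; exact: ID. Qed.

Lemma is_idealM I a x : is_ideal I -> I x -> I (a * x).
Proof. by case=> _ _; apply. Qed.

Lemma is_ideal_set0 : is_ideal [set (0 : A)].
Proof. by split=> [//|_ _ -> ->|a _ ->]; [exact: addr0|exact: mulr0]. Qed.

Lemma is_ideal_principal (x : A) : is_ideal [set y | exists a, y = a * x].
Proof.
split=> [|_ _ [a ->] [b ->]|a _ [b ->]].
- by exists 0; rewrite mul0r.
- by exists (a + b); rewrite mulrDl.
- by exists (a * b); rewrite mulrA.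
Qed.

Lemma ideal_expS_sub I i : ideal_exp I i.+1 `<=` ideal_exp I i.
Proof.
move=> x [s hs ->]; rewrite big_seq; apply: is_ideal_sum => [|p /hs[_ hp]].
  exact: is_ideal_exp.
exact: is_idealM (is_ideal_exp _ _) hp.
Qed.

Lemma ideal_exp_sub I i j : (i <= j)%N -> ideal_exp I j `<=` ideal_exp I i.
Proof.
move/subnK => <-; elim: (j - i)%N => [|e IH] //= x.
by move/(@ideal_expS_sub I (e + i)%N)/IH.
Qed.

Lemma sub_ideal_exp1 I : I `<=` ideal_exp I 1.
Proof.
move=> x Ix; exists [:: (x, 1)]; last by rewrite big_seq1 mulr1.
by move=> p; rewrite inE => /eqP ->.
Qed.

(** If [x] is not a unit, Zorn's lemma applies to the ideals that contain [x] but not 1. A maximal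
    one among them is a maximal ideal, hence equal to [M], which puts [x] in [M]. *)
Lemma local_unit M x : local_with M -> ~ M x -> exists a, a * x = 1.
Proof.
move=> [maxM uniqM] nMx; apply: contrapT => nunit.
pose P J := [/\ is_ideal J, J x & ~ J 1]; pose T := {J : set A | P J}.
pose le_T (J K : T) := `[< sval J `<=` sval K >].
have [||||[J [hJ Jx nJ1]] Jmax] := @Zorn T le_T.
- by move=> J; apply/asboolP.
- move=> J K L /asboolP JK /asboolP KL; apply/asboolP.
  exact: subset_trans KL.
- move=> [J hJ] [K hK] /asboolP /= JK /asboolP /= KJ; apply: eq_exist.
  exact/seteqP.
- move=> C totC.
  (* The empty chain needs an upper bound too: the principal ideal of [x], proper because [x] is not
     a unit. A nonempty chain is bounded by its union. *)
  have [[J0 CJ0]|C0] := pselect (exists J : T, C J); last first.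
    have hx : [/\ is_ideal [set y | exists a, y = a * x],
        (exists a, x = a * x) & ~ (exists a, 1 = a * x)].
      split; [exact: is_ideal_principal|by exists 1; rewrite mul1r|].
      by move=> [a /esym ha]; apply: nunit; exists a.
    exists (exist P _ hx) => J CJ; exfalso.
    by apply: C0; exists J.
  have hU : [/\ is_ideal [set y | exists2 J : T, C J & sval J y],
      (exists2 J : T, C J & sval J x) & ~ (exists2 J : T, C J & sval J 1)].
    split.
    + split.
      * by exists J0 => //; case: (svalP J0) => -[].
      * move=> y z [J CJ Jy] [K CK Kz].
        have [/asboolP JK|/asboolP KJ] := totC _ _ CJ CK.
          exists K => //; case: (svalP K) => hK _ _.
          by apply: is_idealD => //; exact: JK.
        exists J => //; case: (svalP J) => hJ _ _.
        by apply: is_idealD => //; exact: KJ.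
      * move=> a y [J CJ Jy]; exists J => //.
        by case: (svalP J) => hJ _ _; exact: is_idealM.
    + by exists J0 => //; case: (svalP J0).
    + by move=> [J _]; case: (svalP J).
  by exists (exist P _ hU) => J CJ; apply/asboolP => y Jy; exists J.
apply: nMx; suff <- : J = M by [].
apply: uniqM; split=> //; first by move=> JT; move: (nJ1); rewrite JT; apply.
move=> K hK JK; have [K1|nK1] := pselect (K 1).
  right; apply/seteqP; split=> // y _.
  by rewrite -[y]mulr1; exact: is_idealM.
left; have hT : [/\ is_ideal K, K x & ~ K 1] by split=> //; exact: JK.
by have /(congr1 sval) := Jmax (exist P K hT) (asboolT JK).
Qed.

(* If x_0 z <> 0 with z in M^i = M^(i+1), then x_0 y_0 z' <> 0 for some y_0 in M
   and z' in M^i; iterating, the chain of the principal ideals of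
   x_j = x_0 y_0 ... y_(j-1) stabilises, so x_j (1 - a y_j) = 0 for some a. *)
Lemma artinian_nakayama M i : artinian A -> local_with M ->
  ideal_exp M i `<=` ideal_exp M i.+1 -> ideal_exp M i `<=` [set 0].
Proof.
move=> artA locM stab z0 Mz0; apply: contrapT => /= /eqP z0_neq0.
pose P x := exists2 z, ideal_exp M i z & x * z != 0; pose T := {x : A | P x}.
have step (x : T) : exists y : A,
    M y /\ exists2 z, ideal_exp M i z & sval x * y * z != 0.
  case: (svalP x) => z /stab [s hs ->] xz; apply: contrapT => no.
  move/eqP: xz; apply; rewrite mulr_sumr big_seq big1 // => p /hs[Mp1 Mp2].
  apply: contrapT => /eqP xp; apply: no; exists p.1; split=> //.
  by exists p.2 => //; rewrite -mulrA.
pose y x := sval (cid (step x)).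
have yP x : M (y x) /\ exists2 z, ideal_exp M i z & sval x * y x * z != 0.
  by rewrite /y; case: cid.
pose next (x : T) : T := exist P (sval x * y x) (yP x).2.
have x0P : exists2 z, ideal_exp M i z & 1 * z != 0.
  by exists z0 => //; rewrite mul1r.
pose X j := iter j next (exist P 1 x0P).
have [||N /(_ N.+1 (leqnSn _)) EN] :=
    artA (fun j => [set b | exists a, b = a * sval (X j)]).
- by move=> j; exact: is_ideal_principal.
- by move=> j _ [a ->]; exists (a * y (X j)); rewrite /= -mulrA [y _ * _]mulrC.
have : [set b | exists a, b = a * sval (X N)] (sval (X N)).
  by exists 1; rewrite mul1r.
rewrite -EN => -[a /= Ea]; have [MyN _] := yP (X N).
have [[idM MT _] _] := locM.
(* As [y (X N)] lies in [M], this factor is a unit; it annihilates [X N], so [X N] is 0, against the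
   nonzero product that [X N] carries. *)
have nM : ~ M (1 - a * y (X N)).
  move=> M1; apply: MT; apply/seteqP; split=> // b _.
  rewrite -[b]mulr1; apply: is_idealM => //.
  rewrite -[1](subrK (a * y (X N))); apply: is_idealD => //.
  exact: is_idealM.
have [b b1] := local_unit locM nM.
have XN0 : sval (X N) = 0.
  rewrite -[LHS]mul1r -b1 -mulrA mulrBl mul1r {1}Ea.
  by rewrite -mulrA [y _ * _]mulrC subrr mulr0.
by case: (svalP (X N)) => z _; rewrite XN0 mul0r eqxx.
Qed.

End IdealFacts.

(** * Coordinates and linear functionals on quotients of ideals *)

Section QuotientBases.
Variables (k : fieldType) (A : comAlgType k).
Implicit Types U V W : set A.

Lemma is_idealZ U (a : k) x : is_ideal U -> U x -> U (a *: x).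
Proof. by move=> hU; rewrite -mulr_algl; exact: is_idealM. Qed.

(** Functionals are total functions on [A] that are controlled on [U] only: coordinates modulo a
    smaller ideal are picked by choice and are arbitrary outside [U]. *)
Definition linear_on U (l : A -> k) : Prop :=
  forall a x y, U x -> U y -> l (a *: x + y) = a * l x + l y.

Lemma linear_on0 U l : is_ideal U -> linear_on U l -> l 0 = 0.
Proof.
move=> [U0 _ _] hl.
by have := hl (-1) 0 0 U0 U0; rewrite scaler0 add0r mulN1r addNr.
Qed.

Lemma linear_onD U phi x y :
  linear_on U phi -> U x -> U y -> phi (x + y) = phi x + phi y.
Proof. by move=> lin Ux Uy; rewrite -[x]scale1r lin // mul1r scale1r. Qed.

Lemma linear_on_sum U l (I : finType) (c : I -> k) (f : I -> A) :
  is_ideal U -> linear_on U l -> (forall i, U (f i)) ->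
  l (\sum_i c i *: f i) = \sum_i c i * l (f i).
Proof.
move=> hU hl Uf; have [U0 _ _] := hU; have l0 := linear_on0 hU hl.
suff [] : U (\sum_i c i *: f i) /\
    l (\sum_i c i *: f i) = \sum_i c i * l (f i) by [].
apply: (big_ind2 (fun x a => U x /\ l x = a)) => //.
- move=> x a y b [Ux <-] [Uy <-]; split; first exact: is_idealD.
  exact: linear_onD hl Ux Uy.
- move=> i _; split; first exact: is_idealZ.
  by rewrite -[_ *: _]addr0 hl // l0 addr0.
Qed.

(** Existence of coefficients gives coordinate functions by choice; their uniqueness gives
    linearity, the kernel [V] and the values on combinations of the basis. *)
Lemma quot_dim_coord U V d : is_ideal U -> is_ideal V -> V `<=` U ->
  quot_dim U V d ->
  exists e : 'I_d -> A, exists c : A -> 'I_d -> k,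
  [/\ forall i, U (e i),
      forall x, U x -> V (x - \sum_i c x i *: e i),
      forall i, linear_on U (c^~ i),
      forall x, U x -> V x <-> (forall i, c x i = 0) &
      forall r i, c (\sum_i r i *: e i) i = r i].
Proof.
move=> hU hV VU [e Ue basis_e].
have /choice[c cP] x : exists c : {ffun 'I_d -> k},
    U x -> V (x - \sum_i c i *: e i).
  have [Ux|nUx] := pselect (U x); last by exists [ffun=> 0] => /nUx.
  by have [c [hc _]] := basis_e x Ux; exists c.
have c_uniq x r : U x -> V (x - \sum_i r i *: e i) -> forall i, c x i = r i.
  move=> Ux Vx i; have [c' [_ uniq]] := basis_e x Ux.
  have <- : c' = c x by apply: uniq; exact: cP.
  suff /ffunP/(_ i) : c' = [ffun i => r i] by rewrite ffunE.
  apply: uniq; rewrite (eq_bigr (fun i => r i *: e i)) // => j _.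
  by rewrite ffunE.
have U_comb r : U (\sum_i r i *: e i).
  by apply: is_ideal_sum => // j _; apply: is_idealZ.
exists e, (fun x i => c x i); split=> //.
- move=> i a x y Ux Uy.
  have Uz : U (a *: x + y) by apply: is_idealD => //; exact: is_idealZ.
  apply: (c_uniq _ (fun i => a * c x i + c y i)) => //.
  rewrite (eq_bigr (fun i => a *: (c x i *: e i) + c y i *: e i)); last first.
    by move=> j _; rewrite scalerDl scalerA.
  rewrite big_split /= -scaler_sumr opprD addrACA -scalerBr.
  by apply: is_idealD => //; [apply: is_idealZ => //|]; exact: cP.
- move=> x Ux; split=> [Vx i|c0].
    apply: (c_uniq _ (fun=> 0)) => //.
    by rewrite big1 ?subr0 // => j _; rewrite scale0r.
  have := cP x Ux; rewrite big1 ?subr0 // => j _.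
  by rewrite c0 scale0r.
- move=> r i; apply: c_uniq => //.
  by rewrite subrr; case: hV.
Qed.

Lemma quot_dim_nontrivial U V d : is_ideal U -> is_ideal V -> V `<=` U ->
  (0 < d)%N -> quot_dim U V d -> exists2 x, U x & ~ V x.
Proof.
move=> hU hV VU d_gt0 /(quot_dim_coord hU hV VU)[e [c [Ue _ _ cV ce]]].
pose x := \sum_i (fun=> 1 : k) i *: e i.
have Ux : U x by apply: is_ideal_sum => // j _; apply: is_idealZ.
exists x => // /(cV x Ux)/(_ (Ordinal d_gt0)); rewrite ce.
by move/eqP; rewrite oner_eq0.
Qed.

Lemma quot_dim0 U V : quot_dim U V 0 -> U `<=` V.
Proof. by move=> [e _ h] x /h[c [+ _]]; rewrite big_ord0 subr0. Qed.

(** On the span of a basis of [U] modulo [V] this is a square linear system. A vector in its kernel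
    gives an element of [V], whose coordinates vanish, so the matrix is invertible. *)
Lemma quot_dim_solve U V (I : finType) (l : I -> A -> k) :
  is_ideal U -> is_ideal V -> V `<=` U -> quot_dim U V #|I| ->
  (forall i, linear_on U (l i)) ->
  (forall x, U x -> (forall i, l i x = 0) -> V x) ->
  forall b : I -> k, exists2 x, U x & forall i, l i x = b i.
Proof.
move=> hU hV VU /(quot_dim_coord hU hV VU)[e [c [Ue _ _ cV ce]]] hl l_inj b.
have U_comb r : U (\sum_p r p *: e p).
  by apply: is_ideal_sum => // j _; apply: is_idealZ.
pose B := \matrix_(p < #|I|, q < #|I|) l (enum_val q) (e p).
have BE (v : 'rV_#|I|) q : (v *m B) 0 q =
    l (enum_val q) (\sum_p v 0 p *: e p).
  rewrite (linear_on_sum _ hU) // mxE.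
  by apply: eq_bigr => p _; rewrite mxE.
have Bunit : B \in unitmx.
  rewrite -row_free_unit; apply: inj_row_free => v vB0; apply/rowP => p.
  rewrite [RHS]mxE -[LHS](ce (fun p => v 0 p)).
  apply: (cV _ (U_comb _)).1; apply: l_inj => // i.
  by rewrite -[i]enum_rankK -BE vB0 mxE.
pose v := (\row_(q < #|I|) b (enum_val q)) *m invmx B.
exists (\sum_p v 0 p *: e p) => // i.
by rewrite -[i]enum_rankK -BE mulmxKV // mxE.
Qed.

(** A spanning family with as many members as the dimension is free: its coordinate matrix [C] is
    square of full rank. *)
Lemma quot_dim_span_free U V (I : finType) (f : I -> A) :
  is_ideal U -> is_ideal V -> V `<=` U -> quot_dim U V #|I| ->
  (forall i, U (f i)) ->
  (forall x, U x -> exists c : I -> k, V (x - \sum_i c i *: f i)) ->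
  forall c : I -> k, V (\sum_i c i *: f i) -> forall i, c i = 0.
Proof.
move=> hU hV VU /(quot_dim_coord hU hV VU)[e [c [Ue _ clin cV ce]]] Uf fspan.
pose C := \matrix_(p < #|I|, q < #|I|) c (f (enum_val p)) q.
have U_comb (r : I -> k) : U (\sum_i r i *: f i).
  by apply: is_ideal_sum => // j _; apply: is_idealZ.
have CE (r : I -> k) q :
    ((\row_(p < #|I|) r (enum_val p)) *m C) 0 q = c (\sum_i r i *: f i) q.
  rewrite (linear_on_sum _ hU (clin q)) // mxE.
  rewrite [RHS](reindex (@enum_val I I)) /=; last first.
    by exists enum_rank => i _; rewrite ?enum_valK ?enum_rankK.
  by apply: eq_bigr => p _; rewrite !mxE.
have Cfull : row_full C.
  rewrite -sub1mx; apply/row_subP => p.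
  have [r] := fspan _ (Ue p).
  set x := \sum_i _ => Vx; apply/submxP.
  exists (\row_(p < #|I|) r (enum_val p)).
  apply/rowP => q; rewrite CE.
  have UeBx : U (e p - x) by apply: VU.
  have /(_ q) ex0 := (cV _ UeBx).1 Vx.
  have -> : c x q = c (e p) q.
    rewrite -[e p](subrK x) -[e p - x]scale1r (clin q) //; last exact: U_comb.
    by rewrite ex0 mulr0 add0r.
  have -> : e p = \sum_j (j == p)%:R *: e j.
    rewrite (bigD1 p) //= eqxx scale1r big1 ?addr0 // => j /negPf ->.
    by rewrite scale0r.
  by rewrite ce !mxE eq_sym.
move=> r Vr i.
have Cunit : C \in unitmx by rewrite -row_full_unit.
have : (\row_(p < #|I|) r (enum_val p)) *m C = 0.
  by apply/rowP => q; rewrite CE mxE; apply: (cV _ (U_comb r)).1.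
move/(congr1 (mulmx^~ (invmx C))); rewrite mulmxK // mul0mx.
by move/rowP/(_ (enum_rank i)); rewrite !mxE enum_rankK.
Qed.

(** A basis of [U] modulo [V] yields a projection [p] of [U] onto [V]. Following it by the
    coordinate on the line [V / W] extends that coordinate to [U]. *)
Lemma quot_dim1_functional U V W d :
  is_ideal U -> is_ideal V -> is_ideal W -> V `<=` U -> W `<=` V ->
  quot_dim U V d -> quot_dim V W 1 ->
  exists2 phi : A -> k, linear_on U phi &
    forall x, V x -> phi x = 0 -> W x.
Proof.
move=> hU hV hW VU WV.
move=> /(quot_dim_coord hU hV VU)[e [c [Ue ec clin cV _]]].
move=> /(quot_dim_coord hV hW WV)[e' [c' [_ _ c'lin c'W _]]].
pose p x := x - \sum_i c x i *: e i.
exists (fun x => c' (p x) 0) => [a x y Ux Uy|x Vx phix].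
  rewrite -(c'lin 0); [|exact: ec|exact: ec]; congr (c' _ 0).
  rewrite /p scalerBr addrACA -opprD; congr (_ - _).
  rewrite scaler_sumr -big_split /=; apply: eq_bigr => i _.
  by rewrite clin // scalerDl scalerA.
have px : p x = x.
  rewrite /p big1 ?subr0 // => i _.
  by rewrite ((cV x (VU _ Vx)).1 Vx) scale0r.
by apply/c'W => // i; rewrite ord1 -{1}px.
Qed.

End QuotientBases.

(** Pairs are counted by their larger entry: [j] is the larger one in [j.+1] pairs. *)
Lemma card_pairs_le n :
  #|{: {p : 'I_n * 'I_n | (p.1 <= p.2)%N}}| = 'C(n.+1, 2).
Proof.
rewrite card_sig -bin2_sum -sum1_card.
rewrite -(pair_big_dep (fun=> true) (fun i j : 'I_n => (i <= j)%N)
  (fun _ _ => 1%N)) /=.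
rewrite (exchange_big_dep (fun=> true)) //= big_nat_recl // add0n big_mkord.
apply: eq_bigr => j _.
rewrite (eq_bigl (fun i : 'I_n => (i < j.+1)%N)) //.
have hj : (j.+1 <= n)%N by exact: ltn_ord.
by rewrite (big_ord_narrow hj) sum1_card card_ord.
Qed.

(** * Forms in a lifted basis and the isomorphism with the graded algebra *)

Section GradedFrame.
Variables (k : fieldType) (A : comAlgType k) (n : nat).
Implicit Type v : 'I_n -> A.

(** This is the k-span of the degree [i] monomials in [v]. Splitting off one variable at a time
    avoids multi-indices and makes products an easy induction. *)
Fixpoint span_exp v (i : nat) : set A :=
  if i is j.+1 then
    [set x | exists2 s : 'I_n -> A, (forall l, span_exp v j (s l)) &
                                    x = \sum_l v l * s l]
  else [set x | exists c : k, x = c%:A].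

Lemma span_exp_lin v i (c : k) x y :
  span_exp v i x -> span_exp v i y -> span_exp v i (c *: x + y).
Proof.
elim: i x y => [|i IH] x y /=.
  by move=> [a ->] [b ->]; exists (c * a + b); rewrite scalerDl scalerA.
move=> [s Ss ->] [t St ->]; exists (fun l => c *: s l + t l).
  by move=> l; exact: IH.
rewrite scaler_sumr -big_split; apply: eq_bigr => l _ /=.
by rewrite mulrDr scalerAr.
Qed.

Lemma span_exp0 v i : span_exp v i 0.
Proof.
elim: i => [|i IH] /=; first by exists 0; rewrite scale0r.
by exists (fun=> 0) => //; rewrite big1 // => l _; rewrite mulr0.
Qed.

Lemma span_expD v i x y :
  span_exp v i x -> span_exp v i y -> span_exp v i (x + y).
Proof. by rewrite -{2}[x]scale1r; exact: span_exp_lin. Qed.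

Lemma span_expZ v i (c : k) x : span_exp v i x -> span_exp v i (c *: x).
Proof.
move=> Sx; rewrite -[_ *: _]addr0; apply: span_exp_lin => //.
exact: span_exp0.
Qed.

Lemma span_expB v i x y :
  span_exp v i x -> span_exp v i y -> span_exp v i (x - y).
Proof. by move=> Sx Sy; rewrite addrC -scaleN1r; exact: span_exp_lin. Qed.

Lemma span_exp_sum v i (I : Type) (r : seq I) (P : pred I) (F : I -> A) :
  (forall l, P l -> span_exp v i (F l)) ->
  span_exp v i (\sum_(l <- r | P l) F l).
Proof.
by move=> SF; apply: big_ind => //; [exact: span_exp0|exact: span_expD].
Qed.

Lemma span_expM v i j x y :
  span_exp v i x -> span_exp v j y -> span_exp v (i + j) (x * y).
Proof.
elim: i x => [|i IH] x /=.
  by move=> [c ->] Sy; rewrite mulr_algl; exact: span_expZ.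
move=> [s Ss ->] Sy; exists (fun l => s l * y) => [l|]; first exact: IH.
by rewrite mulr_suml; apply: eq_bigr => l _; rewrite mulrA.
Qed.

Lemma span_exp1P v x :
  span_exp v 1 x <-> exists c : 'I_n -> k, x = \sum_l c l *: v l.
Proof.
split=> /= [[s /choice[c sE] ->]|[c ->]].
  by exists c; apply: eq_bigr => l _; rewrite sE mulr_algr.
exists (fun l => (c l)%:A) => [l|]; first by exists (c l).
by apply: eq_bigr => l _; rewrite mulr_algr.
Qed.

Variable m : idealr A.

Lemma iexp_sub i j : (i <= j)%N -> iexp m j `<=` iexp m i.
Proof. exact: ideal_exp_sub. Qed.

Lemma iexp1P x : x \in m <-> iexp m 1 x.
Proof.
split=> [mx|]; first exact: (@sub_ideal_exp1 _ [set` m] x mx).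
exact: (ideal_exp1 (idealr_is_ideal m)).
Qed.

Lemma span_exp_sub v i : (forall l, iexp m 1 (v l)) ->
  span_exp v i `<=` iexp m i.
Proof.
move=> mv; elim: i => [|i IH] // x [s Ss ->].
apply: is_ideal_sum; first exact: iexpP.
by move=> l _; rewrite -add1n; apply: ideal_expD (mv l) (IH _ (Ss l)).
Qed.

(** The classes of [v] span m / m^2; their independence comes from the dimension count in
    [span_exp1_direct]. *)
Definition frame v : Prop :=
  (forall l, iexp m 1 (v l)) /\
  (forall x, iexp m 1 x -> exists2 y, span_exp v 1 y & iexp m 2 (x - y)).

Lemma frame_perturb v w : frame v -> (forall l, iexp m 2 (w l)) ->
  frame (fun l => v l + w l).
Proof.
move=> [mv vspan] mw; split=> [l|x mx].
  apply: is_idealD (iexpP _ 1) (mv l) _.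
  exact: (@iexp_sub 1 2).
have [y /span_exp1P[c ->] mxy] := vspan x mx.
exists (\sum_l c l *: (v l + w l)); first by apply/span_exp1P; exists c.
under eq_bigr do rewrite scalerDr.
rewrite big_split /= opprD addrA; apply: iexpB => //.
apply: is_ideal_sum; first exact: iexpP.
by move=> l _; apply: is_idealZ; [exact: iexpP|].
Qed.

(** An element of m^(i+1) is a sum of products of an element of m and one of m^i. Replacing both
    factors by their leading forms changes each product by an element of m^(i+2). *)
Lemma frame_span v i : (forall x, exists c : k, iexp m 1 (x - c%:A)) ->
  frame v -> forall x, iexp m i x ->
  exists2 y, span_exp v i y & iexp m i.+1 (x - y).
Proof.
move=> resid [mv vspan]; elim: i => [|i IH] x.
  by move=> _; have [c mc] := resid x; exists c%:A => //; exists c.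
case=> s; elim: s x => [|p s IHs] x hs ->.
  exists 0; first exact: span_exp0.
  by rewrite big_nil subrr; exact: iexp0.
have [mp1 mp2] : [set` m] p.1 /\ iexp m i p.2 by apply: hs; rewrite inE eqxx.
have [z Sz mz] : exists2 y, span_exp v i.+1 y &
    iexp m i.+2 (\sum_(q <- s) q.1 * q.2 - y).
  by apply: (IHs _ _ erefl) => q qs; apply: hs; rewrite inE qs orbT.
have [y1 Sy1 my1] := vspan p.1 ((iexp1P _).1 mp1).
have [y2 Sy2 my2] := IH p.2 mp2.
exists (y1 * y2 + z); first by apply: span_expD => //; exact: (span_expM Sy1).
rewrite big_cons opprD addrACA; apply: is_idealD => //; first exact: iexpP.
have -> : p.1 * p.2 - y1 * y2 = (p.1 - y1) * p.2 + y1 * (p.2 - y2).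
  by rewrite mulrBl mulrBr addrA subrK.
apply: is_idealD; first exact: iexpP.
  by rewrite -[i.+2]/(2 + i)%N; exact: ideal_expD my1 mp2.
rewrite -[i.+2]/(1 + i.+1)%N; apply: ideal_expD my2.
exact: (@span_exp_sub v 1).
Qed.

(* a in A is sent to the class of the unique polynomial P with coefficients P_i
   in the i-th graded piece span_exp v i and P(1) = a; uniqueness makes
   a |-> P a morphism of algebras. *)
Lemma graded_frame_iso v d :
  (forall x, exists c : k, iexp m 1 (x - c%:A)) -> frame v ->
  (forall i x, span_exp v i x -> iexp m i.+1 x -> x = 0) ->
  (forall x, iexp m d x -> x = 0) ->
  alg_isomorphic A (gr m).
Proof.
move=> resid fv direct md0.
have Ssub i := @span_exp_sub v i fv.1.
pose graded (p : {poly A}) := forall i, span_exp v i p`_i.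
(* Once the coefficients below [i] vanish, r(1) = 0 expresses the [i]-th one through higher ones,
   which lie in m^(i+1); [direct] then kills it. *)
have graded_eq0 r : graded r -> r.[1] = 0 -> r = 0.
  move=> gr_r r1; apply/polyP => i; rewrite coef0.
  elim/ltn_ind: i => i IH; have [ri|/leq_sizeP->//] := ltnP i (size r).
  apply: (direct i) => //; move: r1; rewrite horner_coef.
  rewrite (bigD1 (Ordinal ri)) //= expr1n mulr1 => /(canRL (addrK _)).
  rewrite sub0r => ->; apply: is_idealN; first exact: iexpP.
  apply: is_ideal_sum; first exact: iexpP.
  move=> j ji; rewrite expr1n mulr1.
  have [lt_ji|lt_ij|eq_ji] := ltngtP j i.
  - by rewrite IH //; exact: iexp0.
  - by apply: iexp_sub lt_ij _ _; exact: Ssub.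
  - by move: ji; rewrite -val_eqE /= eq_ji eqxx.
have graded_uniq p q : graded p -> graded q -> p.[1] = q.[1] -> p = q.
  move=> gp gq pq; apply: subr0_eq; apply: graded_eq0.
    by move=> i; rewrite coefB; apply: span_expB.
  by rewrite hornerD hornerN pq subrr.
(* Leading forms are subtracted degree by degree until the remainder lies in m^d = 0. *)
have graded_exists a : exists2 p, graded p & p.[1] = a.
  suff [p gp mp] : exists2 p, graded p & iexp m d (a - p.[1]).
    by exists p => //; apply/esym/subr0_eq/md0.
  elim: d {md0} => [|e [p gp mp]].
    by exists 0 => // i; rewrite coef0; exact: span_exp0.
  have [t St mt] := frame_span resid fv mp.
  exists (p + t *: 'X^e) => [i|].
    rewrite coefD coefZ coefXn; apply: span_expD => //.
    by case: eqP => [->|_]; rewrite ?mulr1 ?mulr0 //; exact: span_exp0.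
  by rewrite hornerD hornerZ hornerXn expr1n mulr1 opprD addrA.
have graded_rees p : graded p -> p \in rees_pred m.
  by move=> gp; apply/reesP => i; exact: Ssub.
pose P a := s2val (cid2 (graded_exists a)).
have gP a : graded (P a) by rewrite /P; case: cid2.
have P1 a : (P a).[1] = a by rewrite /P; case: cid2.
pose R a : rees m := exist _ (P a) (graded_rees _ (gP a)).
pose f a : gr m := gr_class (R a).
(* Any graded polynomial with value [a] at 1 computes [f a], so each morphism law only needs such a
   polynomial. *)
have fE a (p : rees m) : graded (val p) -> (val p).[1] = a -> f a = gr_class p.
  move=> gp pa; congr gr_class; apply: val_inj.
  by apply: graded_uniq => //=; rewrite P1.
have fB : zmod_morphism f.
  move=> a b; rewrite (fE _ (R a - R b)).
  - exact: (rmorphB \pi_(gr m)%qT).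
  - by move=> i; rewrite rmorphB coefB; apply: span_expB; exact: gP.
  - by rewrite rmorphB hornerD hornerN /= !P1.
have fM : monoid_morphism f.
  split=> [|a b].
    rewrite (fE _ 1) ?gr_class1 //; last by rewrite rmorph1 hornerC.
    move=> i; rewrite rmorph1 coef1; case: i => [|i]; last exact: span_exp0.
    by exists 1; rewrite scale1r.
  rewrite (fE _ (R a * R b)) ?gr_classM //; last first.
    by rewrite rmorphM hornerM /= !P1.
  move=> i; rewrite rmorphM coefM; apply: span_exp_sum => j _.
  have ji : (j <= i)%N by rewrite -ltnS.
  rewrite -[X in span_exp v X](subnKC ji).
  by apply: span_expM; exact: gP.
have fZ : scalable f.
  move=> c a; rewrite (fE _ (rees_const m c * R a)) ?gr_classM //; last first.
    by rewrite rmorphM hornerM /= hornerC P1 mulr_algl.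
  move=> i; rewrite rmorphM /= coefCM mulr_algl.
  by apply: span_expZ; exact: gP.
pose F : {lrmorphism A -> gr m} := HB.pack f
  (GRing.isZmodMorphism.Build _ _ f fB)
  (GRing.isMonoidMorphism.Build _ _ f fM)
  (GRing.isScalable.Build _ _ _ _ f fZ).
have f_inj : injective f.
  move=> a b /gr_class_eq /= Rab; rewrite -[a]P1 -[b]P1; congr (_.[1]).
  apply/polyP => i; apply: subr0_eq; apply: (direct i) (Rab i).
  exact: span_expB (gP a i) (gP b i).
(* For surjectivity, each coefficient of a representative is replaced by its leading form, which
   leaves the class unchanged; the preimage is the value at 1. *)
have /choice[g fg] z : exists a, f a = z.
  elim/quotW: z => p.
  have /choice[t tP] i : exists y,
      span_exp v i y /\ iexp m i.+1 ((val p)`_i - y).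
    by have [y] := frame_span resid fv ((reesP _ _ (valP p)) i); exists y.
  have gq : graded (\poly_(i < size (val p)) t i).
    move=> i; rewrite coef_poly; case: ifP => _; last exact: span_exp0.
    by case: (tP i).
  pose q : rees m :=
    exist (fun p => p \in rees_pred m) _ (graded_rees _ gq).
  exists (val q).[1]; rewrite (fE _ q) //; apply/gr_class_eq => i.
  rewrite /= coef_poly; case: ltnP => [_|pi].
    by rewrite -opprB; apply: is_idealN; [exact: iexpP|case: (tP i)].
  by rewrite nth_default // subrr; exact: iexp0.
by exists F, g => [a|z] /=; [apply: f_inj; rewrite fg|exact: fg].
Qed.
End GradedFrame.

Lemma span_exp_monomials (k : fieldType) (A : comAlgType k) n (v : 'I_n -> A)
    j (P : set A) :
  P 0 -> (forall (c : k) x y, P x -> P y -> P (c *: x + y)) ->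
  (forall s : seq 'I_n, size s = j -> P (\prod_(l <- s) v l)) ->
  span_exp v j `<=` P.
Proof.
elim: j P => [|j IH] P P0 Plin Pmon x /=.
  move=> [c ->]; rewrite -[_ *: _]addr0; apply: Plin => //.
  by have := Pmon [::] erefl; rewrite big_nil.
move=> [s Ss ->]; apply: (big_ind P) => // [y z Py Pz|l _].
  by rewrite -[y]scale1r; exact: Plin.
(* The induction ranges over all [P] so that the factor [v l] can be absorbed into the predicate. *)
apply: (IH (fun y => P (v l * y))) (Ss l) => [|c y z Py Pz|t st].
- by rewrite mulr0.
- by rewrite mulrDr -scalerAr; exact: Plin.
- by have := Pmon (l :: t); rewrite big_cons /= st; apply.
Qed.

(** * The socle and the pairings it induces *)

Section SoclePairing.
Variables (k : fieldType) (A : comAlgType k) (m : idealr A) (n : nat).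
Implicit Type v : 'I_n -> A.

Lemma frame_exists :
  quot_dim (iexp m 1) (iexp m 2) n -> exists v, frame m v.
Proof.
move=> [e me basis_e]; exists e; split=> // x /basis_e[c [mx _]].
by exists (\sum_l c l *: e l) => //; apply/span_exp1P; exists c.
Qed.

Lemma span_exp0_direct v x : span_exp v 0 x -> iexp m 1 x -> x = 0.
Proof.
move=> [c ->] /iexp1P mc; have [->|c0] := eqVneq c 0; first by rewrite scale0r.
have := idealMr c^-1%:A mc.
by rewrite mulr_algl scalerA mulVf // scale1r (idealr1 m).
Qed.

Lemma span_exp1_direct v x : quot_dim (iexp m 1) (iexp m 2) n -> frame m v ->
  span_exp v 1 x -> iexp m 2 x -> x = 0.
Proof.
move=> dim1 [mv vspan] /span_exp1P[c ->] mx.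
rewrite big1 // => l _; suff -> : c l = 0 by rewrite scale0r.
have := quot_dim_span_free (iexpP m 1) (iexpP m 2) (@iexp_sub _ _ m 1 2 isT).
move=> /(_ 'I_n v); rewrite card_ord => /(_ dim1 mv); apply=> // y my.
by have [z /span_exp1P[r ->]] := vspan y my; exists r.
Qed.

Lemma frame_mul v (V : set A) x : frame m v -> is_ideal V ->
  (forall l, V (v l * x)) -> (forall y, iexp m 2 y -> V (y * x)) ->
  forall y, iexp m 1 y -> V (y * x).
Proof.
move=> [mv vspan] hV Vv V2 y my; have [z /span_exp1P[c ->] mz] := vspan y my.
rewrite -[y](subrK (\sum_l c l *: v l)) mulrDl; apply: is_idealD => //.
  exact: V2.
rewrite mulr_suml; apply: is_ideal_sum => // l _.
by rewrite -scalerAl; apply: is_idealZ.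
Qed.

(** The last power m^d is annihilated by m and contains a nonzero [u]. The socle being a line, every
    element of it is a multiple of [u]. *)
Lemma socle_sub d : gorenstein [set` m] ->
  (forall x, iexp m d.+1 x -> x = 0) ->
  quot_dim (iexp m d) (iexp m d.+1) 1 ->
  forall x, (forall y, iexp m 1 y -> y * x = 0) -> iexp m d x.
Proof.
move=> [e _ gen_e] md0 dimd x socx.
have soc y : (forall z, iexp m 1 z -> z * y = 0) ->
    exists c : k, y = c *: e 0.
  move=> socy; have [|c [/= + _]] := gen_e y.
    by move=> z /= mz; apply/socy/iexp1P.
  by rewrite big_ord1 => /subr0_eq ->; exists (c 0).
have [u mu nu] := quot_dim_nontrivial (iexpP m d) (iexpP m d.+1)
  (@iexp_sub _ _ m _ _ (leqnSn d)) (ltn0Sn 0) dimd.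
have [a ua] : exists c : k, u = c *: e 0.
  by apply: soc => z mz; apply: md0; rewrite -add1n; exact: ideal_expD mz mu.
have a0 : a != 0.
  apply/eqP => a0; apply: nu; rewrite ua a0 scale0r; exact: iexp0.
have [b ->] := soc x socx.
have -> : b *: e 0 = (b / a) *: u by rewrite ua scalerA divfK.
by apply: is_idealZ mu; exact: iexpP.
Qed.

Section Pairing.
Variables (v : 'I_n -> A) (e : nat) (phi : A -> k).
Hypothesis fv : frame m v.
Hypothesis nil_m : forall x, iexp m e.+2 x -> x = 0.
Hypothesis socle_m :
  forall x, (forall y, iexp m 1 y -> y * x = 0) -> iexp m e.+1 x.
Hypothesis phi_lin : linear_on (iexp m e) phi.
Hypothesis phi_inj : forall x, iexp m e.+1 x -> phi x = 0 -> x = 0.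

(** Here [e.+1] is the socle degree. Each [v l * x] lies in m^(e+1), where [phi] is injective, so it
    vanishes. As m^2 x lies in m^(e+2) = 0, all of m kills [x], which is thus in the socle. *)
Lemma pairing_nondegenerate x : iexp m e x ->
  (forall l, phi (v l * x) = 0) -> iexp m e.+1 x.
Proof.
move=> mx phix; apply: socle_m.
apply: (frame_mul (V := [set 0]) fv (@is_ideal_set0 A)) => [l|y my] /=.
  by apply: phi_inj => //; rewrite -add1n; exact: ideal_expD (fv.1 l) mx.
by apply: nil_m; rewrite -[e.+2]/(2 + e)%N; exact: ideal_expD my mx.
Qed.

(** The symmetry dim m^e / m^(e+1) = n = dim m / m^2 makes this a square system, and
    [pairing_nondegenerate] makes it invertible. *)
Lemma pairing_solve : quot_dim (iexp m e) (iexp m e.+1) n ->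
  forall b : 'I_n -> k, exists2 x, iexp m e x & forall l, phi (v l * x) = b l.
Proof.
rewrite -[in quot_dim _ _ n](card_ord n) => dim.
apply: (quot_dim_solve (l := fun l x => phi (v l * x)) _ _ _ dim).
- exact: iexpP.
- exact: iexpP.
- exact: iexp_sub.
- move=> l a x y mx my; rewrite mulrDr -scalerAr phi_lin //.
    exact: is_idealM (iexpP _ _) mx.
  exact: is_idealM (iexpP _ _) my.
- exact: pairing_nondegenerate.
Qed.

End Pairing.

(** The span of the monomials lies in the kernel of [phi], which meets m^(e+1) in 0. *)
Lemma functional_direct v e (phi : A -> k) x : frame m v ->
  linear_on (iexp m e) phi ->
  (forall x, iexp m e.+1 x -> phi x = 0 -> x = 0) ->
  (forall s : seq 'I_n, size s = e -> phi (\prod_(l <- s) v l) = 0) ->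
  span_exp v e x -> iexp m e.+1 x -> x = 0.
Proof.
move=> fv phi_lin phi_inj phi_mon Sx mx; apply: phi_inj => //.
have phi0 := linear_on0 (iexpP m e) phi_lin.
suff : [set y | iexp m e y /\ phi y = 0] x by case.
apply: span_exp_monomials Sx => [|c y z [my py] [mz pz]|s ss] /=.
- by split=> //; exact: iexp0.
- split; last by rewrite phi_lin // py pz mulr0 addr0.
  by apply: is_idealD => //; [exact: iexpP|apply: is_idealZ (iexpP _ _) _].
- split; last exact: phi_mon.
  rewrite -ss; elim: s {ss} => [|l s IH] //.
  by rewrite big_cons /= -add1n; exact: ideal_expD (fv.1 l) IH.
Qed.

End SoclePairing.

(** * Correcting the frame so that the functional kills its top monomials *)

Section Corrections.
Variables (k : fieldType) (A : comAlgType k) (m : idealr A) (n : nat).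
Implicit Type v : 'I_n -> A.

Lemma correct_quadrics v (phi : A -> k) : 2%:R != 0 :> k -> frame m v ->
  (forall x, iexp m 4 x -> x = 0) ->
  (forall x, (forall y, iexp m 1 y -> y * x = 0) -> iexp m 3 x) ->
  quot_dim (iexp m 2) (iexp m 3) n ->
  linear_on (iexp m 2) phi ->
  (forall x, iexp m 3 x -> phi x = 0 -> x = 0) ->
  exists v', frame m v' /\
    forall s : seq 'I_n, size s = 2 -> phi (\prod_(l <- s) v' l) = 0.
Proof.
move=> two_neq0 fv nil_m socle_m dim2 phi_lin phi_inj.
have [mv _] := fv.
(* The cross terms [v i * w j] and [v j * w i] each contribute half of what cancels
   [phi (v i * v j)]; the product [w i * w j] lies in m^4 = 0. *)
have /choice[w wP] j : exists w, iexp m 2 w /\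
    forall i, phi (v i * w) = - (phi (v i * v j) / 2%:R).
  have [w mw hw] := pairing_solve fv nil_m socle_m phi_lin phi_inj dim2
    (fun i => - (phi (v i * v j) / 2%:R)).
  by exists w.
have mw j : iexp m 2 (w j) by case: (wP j).
exists (fun l => v l + w l); split; first exact: frame_perturb.
case=> [|i [|j []]] // _; rewrite !big_cons big_nil mulr1.
have mvv : iexp m 2 (v i * v j) by exact: (ideal_expD (mv i) (mv j)).
have mvw i' j' : iexp m 2 (v i' * w j').
  by apply: (@iexp_sub _ _ m 2 3) => //; exact: (ideal_expD (mv i') (mw j')).
have -> : (v i + w i) * (v j + w j) = v i * v j + (v i * w j + v j * w i).
  have ww0 : w i * w j = 0 by apply: nil_m; exact: (ideal_expD (mw i) (mw j)).
  by rewrite mulrDl !mulrDr ww0 addr0 addrA [w i * _]mulrC.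
rewrite (linear_onD phi_lin) //; last by apply: is_idealD => //; exact: iexpP.
rewrite (linear_onD phi_lin) // !(wP _).2 [v j * v i]mulrC -opprD -mulrDl.
by rewrite -mulr2n -[X in X / _]mulr_natr mulfK // subrr.
Qed.

Let pairs := {p : 'I_n * 'I_n | (p.1 <= p.2)%N}.

Lemma pairs_wlog (Q : 'I_n -> 'I_n -> Prop) :
  (forall i j, Q i j -> Q j i) ->
  (forall p : pairs, Q (val p).1 (val p).2) -> forall i j, Q i j.
Proof.
move=> Qsym Qle i j; pose le_pair (p : 'I_n * 'I_n) : Prop := (p.1 <= p.2)%N.
have [ij|/ltnW ji] := leqP i j.
  exact: (Qle (exist le_pair (i, j) ij)).
by apply: Qsym; exact: (Qle (exist le_pair (j, i) ji)).
Qed.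

(** By commutativity, indices i <= j suffice, so the number of generators is exactly the dimension
    assumed for m^2 / m^3. *)
Lemma span_exp2_pairs v x : span_exp v 2 x ->
  exists c : pairs -> k, x = \sum_p c p *: (v (val p).1 * v (val p).2).
Proof.
pose P : set A := [set x | exists c : pairs -> k,
  x = \sum_p c p *: (v (val p).1 * v (val p).2)].
apply: (@span_exp_monomials _ _ _ v 2 P).
- by exists (fun=> 0); rewrite big1 // => p _; rewrite scale0r.
- move=> a _ _ [c ->] [d ->]; exists (fun p => a * c p + d p).
  rewrite scaler_sumr -big_split; apply: eq_bigr => p _ /=.
  by rewrite scalerDl scalerA.
- case=> [|i [|j []]] // _; rewrite !big_cons big_nil mulr1.
  move: i j; apply: pairs_wlog => [i j|p]; first by rewrite mulrC.
  exists (fun q => (q == p)%:R); rewrite (bigD1 p) //= eqxx scale1r.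
  by rewrite big1 ?addr0 // => q /negPf ->; rewrite scale0r.
Qed.

(* Maximality of the dimension of m^2 / m^3 forces the quadratic monomials in
   the frame to be independent modulo m^3. *)
Lemma span_exp2_direct v x : (forall x, exists c : k, iexp m 1 (x - c%:A)) ->
  frame m v -> quot_dim (iexp m 2) (iexp m 3) 'C(n.+1, 2) ->
  span_exp v 2 x -> iexp m 3 x -> x = 0.
Proof.
move=> resid fv; rewrite -card_pairs_le => dim2 /span_exp2_pairs[c ->] mx.
have [mv _] := fv.
rewrite big1 // => p _; suff -> : c p = 0 by rewrite scale0r.
apply: (quot_dim_span_free (iexpP m 2) (iexpP m 3)
  (@iexp_sub _ _ m 2 3 isT) dim2) mx p.
- by move=> p; exact: (ideal_expD (mv _) (mv _)).
- move=> y my.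
  by have [z /span_exp2_pairs[r ->]] := frame_span resid fv my; exists r.
Qed.

Lemma correct_cubics v (phi : A -> k) : 3%:R != 0 :> k -> frame m v ->
  (forall x, iexp m 5 x -> x = 0) ->
  (forall x, (forall y, iexp m 1 y -> y * x = 0) -> iexp m 4 x) ->
  quot_dim (iexp m 2) (iexp m 3) 'C(n.+1, 2) ->
  quot_dim (iexp m 3) (iexp m 4) n ->
  linear_on (iexp m 3) phi ->
  (forall x, iexp m 4 x -> phi x = 0 -> x = 0) ->
  exists v', frame m v' /\
    forall s : seq 'I_n, size s = 3 -> phi (\prod_(l <- s) v' l) = 0.
Proof.
move=> three_neq0 fv nil_m socle_m dim2 dim3 phi_lin phi_inj.
have [mv _] := fv.
have mvv i j : iexp m 2 (v i * v j) by exact: (ideal_expD (mv i) (mv j)).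
have sub34 : iexp m 4 `<=` iexp m 3 by exact: iexp_sub.
have mvvx x i j : iexp m 2 x -> iexp m 3 (v i * v j * x).
  by move=> mx; apply: sub34; exact: (ideal_expD (mvv i j) mx).
(* If [phi] kills all [v i * v j * x], the pairing on m^3 puts every [v l * x] in m^4; hence m x
   lies in m^4 and m^2 x in m^5 = 0. *)
have nondegenerate x : iexp m 2 x ->
    (forall p : pairs, phi (v (val p).1 * v (val p).2 * x) = 0) -> iexp m 3 x.
  move=> mx /(@pairs_wlog (fun i j => phi (v i * v j * x) = 0)) phix.
  have {}phix i j : phi (v i * v j * x) = 0.
    by apply: phix => i' j'; rewrite [v i' * _]mulrC.
  have mvx l : iexp m 3 (v l * x) by exact: (ideal_expD (mv l) mx).
  have mvx4 l : iexp m 4 (v l * x).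
    apply: (pairing_nondegenerate fv nil_m socle_m phi_inj) => // i.
    by rewrite mulrA.
  have m1x y : iexp m 1 y -> iexp m 4 (y * x).
    apply: (frame_mul fv) => //; first exact: iexpP.
    by move=> z mz; exact: (ideal_expD mz mx).
  have m2x y : iexp m 2 y -> y * x = 0.
    move=> [s hs ->]; rewrite mulr_suml big_seq big1 // => p /hs[mp1 mp2].
    rewrite -mulrA; apply: nil_m.
    exact: (ideal_expD ((iexp1P m _).1 mp1) (m1x _ mp2)).
  (* The values [phi (v l * x)] may be nonzero, but some [u] in m^3 has the same ones. Then x - u is
     killed by m, so it lies in m^4, and [x] lies in m^3. *)
  have [u mu hu] := pairing_solve fv nil_m socle_m phi_lin phi_inj dim3
    (fun l => phi (v l * x)).
  rewrite -[x](subrK u); apply: (is_idealD _ _ mu); first exact: iexpP.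
  apply: (sub34); apply: (socle_m).
  apply: (frame_mul (V := [set 0]) fv (@is_ideal_set0 A)) => [l|y my] /=.
    have mvu : iexp m 4 (v l * u) by exact: (ideal_expD (mv l) mu).
    apply: phi_inj; first by rewrite mulrBr; exact: iexpB.
    rewrite mulrBr addrC -scaleN1r phi_lin; first by rewrite hu mulN1r addNr.
      exact: sub34.
    exact: mvx.
  rewrite mulrBr m2x // sub0r (nil_m (y * u)) ?oppr0 //.
    exact: (ideal_expD my mu).
(* The conditions on [w], one per pair a <= b, are as many as dim m^2 / m^3. The factor 1/3 shares
   the correction among the three terms that are linear in [w]. *)
have /choice[w wP] i : exists w, iexp m 2 w /\
    forall a b, phi (v a * v b * w) = - (phi (v a * v b * v i) / 3%:R).
  pose l (p : pairs) x := phi (v (val p).1 * v (val p).2 * x).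
  have := dim2; rewrite -card_pairs_le => dim2'.
  have [||w mw hw] := quot_dim_solve (l := l) (iexpP m 2) (iexpP m 3)
    (@iexp_sub _ _ m 2 3 isT) dim2' _ _
    (fun p => - (phi (v (val p).1 * v (val p).2 * v i) / 3%:R)).
  - move=> p a x y mx my; rewrite /l mulrDr -scalerAr phi_lin //; exact: mvvx.
  - exact: nondegenerate.
  - exists w; split=> //; apply: pairs_wlog => [a b|p]; last exact: hw.
    by rewrite [v b * _]mulrC.
have mw j : iexp m 2 (w j) by case: (wP j).
exists (fun l => v l + w l); split; first exact: frame_perturb.
case=> [|a [|b [|c []]]] // _; rewrite !big_cons big_nil mulr1.
have mvvw a' b' c' : iexp m 3 (v a' * v b' * w c') by exact: mvvx.
have mvvv : iexp m 3 (v a * v b * v c) by exact: (ideal_expD (mvv a b) (mv c)).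
(* Terms with two or three factors [w] lie in m^5 = 0. *)
have ww0 x i j : iexp m 1 x -> x * (w i * w j) = 0.
  move=> mx; apply: nil_m.
  exact: (ideal_expD mx (ideal_expD (mw i) (mw j))).
have -> : (v a + w a) * ((v b + w b) * (v c + w c)) =
    v a * v b * v c + (v b * v c * w a + (v a * v c * w b + v a * v b * w c)).
  have -> : (v a + w a) * ((v b + w b) * (v c + w c)) =
      v a * v b * v c +
      (v b * v c * w a + (v a * v c * w b + v a * v b * w c)) +
      (v a * (w b * w c) + v b * (w a * w c) + v c * (w a * w b) +
       w a * (w b * w c)) by ring.
  by rewrite !ww0 // ?addr0 //; exact: (@iexp_sub _ _ m 1 2).
rewrite !(linear_onD phi_lin) //; last 2 first.
- by apply: is_idealD => //; exact: iexpP.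
- by do 2 (apply: is_idealD => //; first exact: iexpP).
rewrite !(wP _).2.
have -> : v b * v c * v a = v a * v b * v c by rewrite mulrC mulrA.
have -> : v a * v c * v b = v a * v b * v c by rewrite mulrAC.
rewrite -!opprD -!mulrDl -mulr2n -mulrS.
by rewrite -[X in X / _]mulr_natr mulfK // subrr.
Qed.

End Corrections.

(** * Assembling the two cases of the theorem *)

Lemma residue_constants (k : fieldType) (A : comAlgType k) (m : idealr A) :
  bijective (fun c : k => (\pi_({ideal_quot m}) (c%:A : A))%qT) ->
  forall x : A, exists c : k, iexp m 1 (x - c%:A).
Proof.
case=> g _ gK x; exists (g (\pi_({ideal_quot m}) x)%qT).
apply/iexp1P; rewrite Quotient.idealrBE; apply/eqP.
by rewrite gK.
Qed.

Lemma pchar_natr_neq0 (k : fieldType) p :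
  prime p -> p \notin [pchar k] -> p%:R != 0 :> k.
Proof. by move=> p_pr; rewrite inE /= p_pr. Qed.

Theorem proposition1p1 (k : fieldType) (A : comAlgType k) (m : idealr A) :
  2%N \notin [pchar k] -> 3%N \notin [pchar k] ->
  artinian A ->
  local_with [set` m] ->
  bijective (fun c : k => (\pi_({ideal_quot m}) (c%:A : A))%qT) ->
  gorenstein [set` m] ->
  (exists n : nat,
     hilbert_function [set` m] [:: 1; n; n; 1]%N \/
     hilbert_function [set` m] [:: 1; n; 'C(n.+1, 2); n; 1]%N) ->
  alg_isomorphic A (gr m).
Proof.
move=> /pchar_natr_neq0-/(_ isT) two_neq0 /pchar_natr_neq0-/(_ isT) three_neq0.
move=> artA locA /residue_constants resid gorA.
(* This is used just past the end of the Hilbert function, at 4 or 5, where the default value of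
   [nth] gives dimension 0. *)
have nilpotent d : quot_dim (iexp m d) (iexp m d.+1) 0 ->
    forall x, iexp m d x -> x = 0.
  by move=> /quot_dim0; exact: artinian_nakayama.
case=> n [] [_ dim].
- have nil_m := nilpotent 4 (dim 4).
  have socle_m := socle_sub gorA nil_m (dim 3).
  have [v0 fv0] := frame_exists (dim 1%N).
  have [phi phi_lin phi_inj] := quot_dim1_functional (iexpP m 2) (iexpP m 3)
    (iexpP m 4) (@iexp_sub _ _ m 2 3 isT) (@iexp_sub _ _ m 3 4 isT)
    (dim 2) (dim 3).
  have {}phi_inj x : iexp m 3 x -> phi x = 0 -> x = 0.
    by move=> mx px; apply/nil_m/phi_inj.
  have [v [fv phi_v]] :=
    correct_quadrics two_neq0 fv0 nil_m socle_m (dim 2) phi_lin phi_inj.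
  apply: (graded_frame_iso resid fv _ nil_m) => i x.
  (* From degree 3 on, [x] lies in m^4 = 0; only degree 2 uses the corrected frame. *)
  case: i => [|[|[|i]]]; first exact: span_exp0_direct.
  + exact: span_exp1_direct (dim 1%N) fv.
  + exact: functional_direct fv phi_lin phi_inj phi_v.
  + by move=> _ mx; apply/nil_m/(iexp_sub _ mx).
- have nil_m := nilpotent 5 (dim 5).
  have socle_m := socle_sub gorA nil_m (dim 4).
  have [v0 fv0] := frame_exists (dim 1%N).
  have [phi phi_lin phi_inj] := quot_dim1_functional (iexpP m 3) (iexpP m 4)
    (iexpP m 5) (@iexp_sub _ _ m 3 4 isT) (@iexp_sub _ _ m 4 5 isT)
    (dim 3) (dim 4).
  have {}phi_inj x : iexp m 4 x -> phi x = 0 -> x = 0.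
    by move=> mx px; apply/nil_m/phi_inj.
  have [v [fv phi_v]] := correct_cubics three_neq0 fv0 nil_m socle_m
    (dim 2) (dim 3) phi_lin phi_inj.
  apply: (graded_frame_iso resid fv _ nil_m) => i x.
  (* Degree 2 rests on the maximal dimension of m^2 / m^3, degree 3 on the corrected frame, and from
     degree 4 on [x] lies in m^5 = 0. *)
  case: i => [|[|[|[|i]]]]; first exact: span_exp0_direct.
  + exact: span_exp1_direct (dim 1%N) fv.
  + exact: span_exp2_direct resid fv (dim 2).
  + exact: functional_direct fv phi_lin phi_inj phi_v.
  + by move=> _ mx; apply/nil_m/(iexp_sub _ mx).
Qed.
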